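(* For every $\varepsilon>0$, every countably infinite metric space $X$ has an infinite subset $S\subseteq X$ which (with the restricted metric) embeds into an ultrametric space with distortion $1+\varepsilon$.
   Context: A metric space $(X,d_X)$ is said to embed with distortion $D\geq 1$ in a metric space $(Y,d_Y)$ if there exist a map $f:X\to Y$ and a constant $r>0$ such that $r\, d_X(x,y)\leq d_Y(f(x),f(y))\leq D r\, d_X(x,y)$ for all $x,y\in X$. A metric space $(U,\rho)$ is called an ultrametric space if $\rho(x,y)\leq \max\{\rho(x,z),\rho(z,y)\}$ for all $x,y,z\in U$. *)

(* Defs.v *)
From HB Require Import structures.
From mathcomp Require Import all_boot all_order all_algebra.
From mathcomp Require Import boolp classical_sets functions cardinality reals topology.

Set Implicit Arguments.
Unset Strict Implicit.
Unset Printing Implicit Defensive.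

Import Order.TTheory GRing.Theory Num.Theory.

Local Open Scope classical_set_scope.
Local Open Scope ring_scope.

Section SubsetMetric.
Context {R : realType} {X : metricType R} (S : set X).

Definition subset_mdist (x y : set_type S) : R := mdist (val x) (val y).

Fact subset_mdist_ge0 x y : 0 <= subset_mdist x y.
Proof. exact: mdist_ge0. Qed.

Fact subset_mdist_positivity x y : subset_mdist x y = 0 -> x = y.
Proof. by move=> /mdist_positivity/val_inj. Qed.

Fact subset_ballE (x : set_type S) (e : R) :
  ball x e = [set y | subset_mdist x y < e].
Proof.
apply/seteqP; split=> y /=; rewrite /subset_mdist.
  by move=> xy; have : ball (val x) e (val y) by []; rewrite ballEmdist.
by move=> xy; have : ball (val x) e (val y) by rewrite ballEmdist.
Qed.

HB.instance Definition _ := PseudoMetric_isMetric.Build R (set_type S)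
  subset_mdist_ge0 subset_mdist_positivity subset_ballE.

End SubsetMetric.

Section Embeddings.
Context {R : realType}.

Definition embeds_with_distortion (D : R) (X Y : metricType R) : Prop :=
  1 <= D /\
  exists (f : X -> Y) (r : R), 0 < r /\
    forall x y : X, r * mdist x y <= mdist (f x) (f y) <= D * r * mdist x y.

Definition ultrametric_space (U : metricType R) : Prop :=
  forall x y z : U, mdist x y <= Num.max (mdist x z) (mdist z y).

End Embeddings.

(* Main.v *)
(** Fix an ultrafilter F on X refining the cofinite filter, and put
    b(x) = lim_F d(x, y), in [0, +oo].  It suffices to find a : X -> R such that
    for F-almost all x, for F-almost all y, a(x), a(y) > 0 and
    d(x, y) = (1 +- eta) max(a(x), a(y)): points selected greedily one after the
    other then form an infinite set on which d is close to the ultrametric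
    max(a(x), a(y)).  If some b(x0) is infinite, take a = d(x0, .).  Otherwise b
    has a finite limit B along F; take a = B if B > 0, and a = b if B = 0. *)

From HB Require Import structures.
Require Import Defs.
From mathcomp Require Import all_boot all_order all_algebra.
From mathcomp Require Import boolp classical_sets functions cardinality reals topology.
From mathcomp Require Import lra.

Import Order.TTheory GRing.Theory Num.Theory.

Local Open Scope classical_set_scope.
Local Open Scope card_scope.
Local Open Scope ring_scope.

(** A copy of [T] that records [a] and its positivity, so that the metric [max_dist] can be attached
    to it even when [T] already carries a metric. *)
Definition max_space {R : realType} {T : choiceType} (a : T -> R)
  (a_gt0 : forall x, 0 < a x) : Type := T.

Section MaxSpace.
Context {R : realType} {T : choiceType} (a : T -> R) (a_gt0 : forall x, 0 < a x).

HB.instance Definition _ := Choice.on (max_space a a_gt0).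

Definition max_dist (x y : max_space a a_gt0) : R :=
  if x == y then 0 else Num.max (a x) (a y).

Lemma max_dist_ge0 x y : 0 <= max_dist x y.
Proof. by rewrite /max_dist; case: eqP => // _; rewrite le_max ltW. Qed.

Lemma max_distxx x : max_dist x x = 0.
Proof. by rewrite /max_dist eqxx. Qed.

Lemma max_dist_positivity x y : max_dist x y = 0 -> x = y.
Proof.
rewrite /max_dist; case: eqP => // _ m0.
by have := a_gt0 x; rewrite ltNge -m0 le_max lexx.
Qed.

Lemma max_dist_sym x y : max_dist x y = max_dist y x.
Proof. by rewrite /max_dist eq_sym maxC. Qed.

Lemma max_dist_ultra x y z :
  max_dist x y <= Num.max (max_dist x z) (max_dist z y).
Proof.
have [->|xz] := eqVneq x z; first by rewrite le_max lexx orbT.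
have [->|zy] := eqVneq z y; first by rewrite le_max lexx.
rewrite {2 3}/max_dist (negbTE xz) (negbTE zy) /max_dist.
case: eqP => _; first by rewrite !le_max ltW.
by rewrite ge_max !le_max !lexx !orbT.
Qed.

Lemma max_dist_triangle y x z : max_dist x z <= max_dist x y + max_dist y z.
Proof.
apply: (le_trans (max_dist_ultra x z y)).
by rewrite ge_max lerDl lerDr !max_dist_ge0.
Qed.

HB.instance Definition _ := isMetric.Build R (max_space a a_gt0)
  max_distxx max_dist_positivity max_dist_sym max_dist_triangle.

Lemma ultrametric_max_space : ultrametric_space (max_space a a_gt0).
Proof. exact: max_dist_ultra. Qed.

End MaxSpace.

(** The limit is the supremum of the [t] with [t <= f] almost everywhere. If [f < sup E + e] failed
    to hold almost everywhere, the ultrafilter would contain the complement and put [sup E + e]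
    itself into [E]. *)
Lemma ultrafilter_real_limit {R : realType} {T : Type} (F : set_system T)
    (f : T -> R) (m M : R) : UltraFilter F ->
  (\forall x \near F, m <= f x <= M) ->
  exists b, forall e : R, 0 < e -> \forall x \near F, `|f x - b| < e.
Proof.
move=> FU fmM; pose E := [set t | \forall x \near F, t <= f x].
have supE : has_sup E.
  split; first by exists m; apply: filterS fmM => x /andP[].
  exists M => t Et; have [x [tx /andP[_ xM]]] := filter_ex (filterI Et fmM).
  exact: le_trans tx xM.
exists (sup E) => e e0.
have [t Et et] := sup_adherent e0 supE.
have Fub : \forall x \near F, f x < sup E + e.
  have [Ef|] := in_ultra_setVsetC [set x | sup E + e <= f x] FU.
    have := sup_upper_bound supE Ef.
    by rewrite gerDl leNgt e0.
  by apply: filterS => x /= /negP; rewrite -ltNge.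
apply: filterS2 Et Fub => x tx xb.
by rewrite ltr_distl (lt_le_trans et tx).
Qed.

Section Selection.
Context {T : choiceType} (F : set_system T) {FF : ProperFilter F}.
Variable P : T -> T -> Prop.

(** Each point of a finite list in [G] excludes only an [F]-negligible set of successors, so a
    further point of [G] is always available. [P] then holds from earlier to later points, whence
    the disjunction. *)
Lemma greedy_selection : (\forall x \near F, \forall y \near F, x != y /\ P x y) ->
  exists S, infinite_set S /\
    forall x y, S x -> S y -> x != y -> P x y \/ P y x.
Proof.
move=> FP; pose G := [set x | \forall y \near F, x != y /\ P x y].
(* The hypothesis on [s] sits under the existential so that [choice] gives a function on all lists;
   on lists outside [G] its value is arbitrary. *)
have next (s : seq T) : exists y, (forall x, x \in s -> G x) ->
    G y /\ forall x, x \in s -> x != y /\ P x y.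
  have [sG|nsG] := pselect (forall x, x \in s -> G x); last first.
    by have [y _] := filter_ex FP; exists y => /nsG.
  suff /filter_ex[y [Gy sy]] :
      \forall y \near F, G y /\ forall x, x \in s -> x != y /\ P x y.
    by exists y.
  apply: filterI => //; elim: s sG => [|z s IH] sG; first exact: nearW.
  have Fs : \forall y \near F, forall x, x \in s -> x != y /\ P x y.
    by apply: IH => x xs; apply: sG; rewrite inE xs orbT.
  have Fz : G z by apply: sG; rewrite inE eqxx.
  apply: filterS2 Fs Fz => y sy zy x.
  by rewrite inE => /predU1P[->|/sy].
have [nx nxP] := choice next.
(* [l n] lists the first [n] selected points, latest first. *)
pose l := fix l n := if n is k.+1 then nx (l k) :: l k else [::].
have lG n : forall x, x \in l n -> G x.
  elim: n => // n IH x; rewrite inE => /predU1P[->|/IH//].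
  by have [] := nxP _ IH.
pose u n := nx (l n).
have ul m n : (m < n)%N -> u m \in l n.
  elim: n => // n IH; rewrite ltnS leq_eqVlt => /predU1P[->|/IH mn].
    by rewrite inE eqxx.
  by rewrite inE mn orbT.
have uP m n : (m < n)%N -> u m != u n /\ P (u m) (u n).
  by move=> mn; have [_] := nxP _ (lG n); apply; exact: ul.
exists (range u); split; last first.
  move=> _ _ [m _ <-] [n _ <-]; case: (ltngtP m n) => [/uP[]|/uP[]|->].
  - by left.
  - by right.
  - by rewrite eqxx.
have uI : injective u.
  move=> m n umn; case: (ltngtP m n) => // /uP[].
    by rewrite umn eqxx.
  by rewrite umn eqxx.
rewrite (eq_finite_set (inj_card_eq (in2W uI))); exact: infinite_nat.
Qed.

End Selection.

Definition max_like {R : realType} {X : metricType R} (eta : R) (a : X -> R)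
    (x y : X) : Prop :=
  [/\ 0 < a x, 0 < a y &
   (1 - eta) * Num.max (a x) (a y) <= mdist x y
     <= (1 + eta) * Num.max (a x) (a y)].

Lemma max_like_sym {R : realType} {X : metricType R} (eta : R) (a : X -> R) x y :
  max_like eta a x y -> max_like eta a y x.
Proof. by case=> ax ay; rewrite metric_sym maxC. Qed.

Section LimitScale.
Context {R : realType} {X : metricType R} (F : set_system X).
Context {FU : UltraFilter F}.
Hypothesis F_free : forall x, \forall y \near F, x != y.
Variable eta : R.
Hypothesis eta_gt0 : 0 < eta.

Lemma max_like_unbounded (x0 : X) :
  (forall M, \forall y \near F, M < mdist x0 y) ->
  \forall x \near F, \forall y \near F, max_like eta (mdist x0) x y.
Proof.
move=> x0oo; apply: filterS (F_free x0) => x; rewrite -mdist_gt0 => dx.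
(* By the triangle inequality, [mdist x y] differs from [mdist x0 y] by at most [mdist x0 x], which
   is below [eta * mdist x0 y] for such [y]. *)
apply: filterS2 (x0oo (mdist x0 x)) (x0oo (mdist x0 x / eta)) => y xy.
rewrite ltr_pdivrMr// => xye.
have := metric_triangle x0 x y; have := metric_triangle x x0 y.
have := metric_triangle x0 y x; rewrite (metric_sym x x0) (metric_sym y x).
by split; [| |rewrite max_r ?(ltW xy)//]; lra.
Qed.

Variable b : X -> R.
Hypothesis b_lim : forall x (e : R), 0 < e -> \forall y \near F, `|mdist x y - b x| < e.

Lemma limit_dist_ge0 x : 0 <= b x.
Proof.
rewrite leNgt; apply/negP => bx; have := b_lim x (- b x).
rewrite oppr_gt0 => /(_ bx) /filter_ex[y]; rewrite ltr_distl.
by have := mdist_ge0 x y; lra.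
Qed.

Lemma limit_dist_converges :
  exists B, forall e : R, 0 < e -> \forall x \near F, `|b x - B| < e.
Proof.
have [x0 _] := filter_ex (filterT : F setT).
(* For a suitable [y], [b x < mdist x y + 1], while [mdist x x0] and [mdist x0 y] are both below
   [b x0 + 1]. *)
apply: (ultrafilter_real_limit F b 0 (2 * b x0 + 3)).
apply: filterS (b_lim x0 1 ltr01) => x x0x; rewrite limit_dist_ge0 /=.
have [y [+ +]] := filter_ex (filterI (b_lim x0 1 ltr01) (b_lim x 1 ltr01)).
move: x0x; rewrite !ltr_distl.
by have := metric_triangle x x0 y; rewrite (metric_sym x x0); lra.
Qed.

Lemma max_like_equilateral (B : R) : 0 < B ->
  (forall e : R, 0 < e -> \forall x \near F, `|b x - B| < e) ->
  \forall x \near F, \forall y \near F, max_like eta (fun=> B) x y.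
Proof.
(* Half of the error [eta * B] goes to [b x] against [B], half to [mdist x y] against [b x]. *)
move=> B0 bB; have e0 : 0 < eta * B / 2 by rewrite divr_gt0 ?mulr_gt0.
apply: filterS (bB _ e0) => x bx; apply: filterS (b_lim x _ e0) => y.
by move: bx; rewrite !ltr_distl => ? ?; split => //; rewrite maxxx; lra.
Qed.

Lemma max_like_shrinking :
  (forall e : R, 0 < e -> \forall x \near F, `|b x| < e) ->
  \forall x \near F, \forall y \near F, max_like eta b x y.
Proof.
move=> b0.
(* Two points with b = 0 are both the limit of F, hence equal. *)
have bF : \forall x \near F, 0 < b x.
  have [|bF] := in_ultra_setVsetC [set x | 0 < b x] FU; first by [].
  have [x bx] := filter_ex bF.
  have [y [/= by0]] := filter_ex (filterI bF (F_free x)).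
  rewrite -mdist_gt0 => xy; exfalso.
  have e0 : 0 < mdist x y / 2 by rewrite divr_gt0.
  have [z [+ +]] := filter_ex (filterI (b_lim x _ e0) (b_lim y _ e0)).
  move: bx by0 => /= /negP + /negP; rewrite -!leNgt !ltr_distl.
  by have := metric_triangle x z y; rewrite (metric_sym z y); lra.
(* With [x] fixed, almost all [y] have [b y < b x], so the maximum is [b x], the limit of
   [mdist x y]. *)
apply: filterS (bF) => x bx.
have ebx : 0 < eta * b x by rewrite mulr_gt0.
apply: filterS3 bF (b0 _ bx) (b_lim x _ ebx) => y by0.
rewrite (gtr0_norm by0) ltr_distl => yx dxy.
by split=> //; rewrite max_l ?(ltW yx)//; lra.
Qed.

End LimitScale.

Lemma exists_max_like {R : realType} {X : metricType R} (F : set_system X)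
    (eta : R) : UltraFilter F -> (forall x, \forall y \near F, x != y) -> 0 < eta ->
  exists a : X -> R, \forall x \near F, \forall y \near F, max_like eta a x y.
Proof.
move=> FU Ffree eta0.
have [[x0 x0oo]|Fbnd] :=
    pselect (exists x0 : X, forall M, \forall y \near F, M < mdist x0 y).
  by exists (mdist x0); exact: max_like_unbounded.
have /choice[b bP] (x : X) :
    exists bx, forall e : R, 0 < e -> \forall y \near F, `|mdist x y - bx| < e.
  have [M xM] : exists M, ~ \forall y \near F, M < mdist x y.
    by apply/existsNP => xoo; apply: Fbnd; exists x.
  apply: (ultrafilter_real_limit F (mdist x) 0 M).
  (* For an ultrafilter, failing to exceed [M] almost everywhere means being at most [M] almost
     everywhere. *)
  have [//|] := in_ultra_setVsetC [set y | M < mdist x y] FU.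
  by apply: filterS => y /= /negP; rewrite -leNgt mdist_ge0.
have [B bB] := limit_dist_converges F b bP.
have : 0 <= B.
  rewrite leNgt; apply/negP => B0; have := bB (- B).
  rewrite oppr_gt0 => /(_ B0) /filter_ex[x]; rewrite ltr_distl.
  have : 0 <= b x by exact: limit_dist_ge0 bP x.
  by lra.
rewrite le_eqVlt => /predU1P[B0|B0].
  exists b; apply: max_like_shrinking => // e /bB.
  by rewrite -B0; under eq_near do rewrite subr0.
by exists (fun=> B); exact: max_like_equilateral bB.
Qed.

Theorem theorem1p2 (R : realType) (eps : R) (eps_gt0 : 0 < eps)
    (X : metricType R) (X_countably_infinite : [set: X] #= [set: nat]) :
  exists S : set X, infinite_set S /\
    exists U : metricType R, ultrametric_space U /\
      embeds_with_distortion (1 + eps) (set_type S : metricType R) U.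
Proof.
have Xinf : infinite_set [set: X].
  by rewrite (eq_finite_set X_countably_infinite); exact: infinite_nat.
have [F [FU sF]] := ultraFilterLemma (frechet_properfilter Xinf).
have Ffree (x : X) : \forall y \near F, x != y.
  apply: sF; rewrite /frechet_filter /=.
  apply: sub_finite_set (finite_set1 x) => y /= /negP.
  by rewrite negbK => /eqP.
(* Solves (1 + eta) / (1 - eta) = 1 + eps. *)
pose eta := eps / (2 + eps).
have eta0 : 0 < eta by rewrite divr_gt0// addr_gt0.
have etaE : eta * (2 + eps) = eps by rewrite divfK// gt_eqF// addr_gt0.
have [a aP] := exists_max_like F eta FU Ffree eta0.
have [S [Sinf SP]] : exists S, infinite_set S /\
    forall x y, S x -> S y -> x != y -> max_like eta a x y \/ max_like eta a y x.
  by apply: (greedy_selection F); apply: filterS aP => x; exact: filterI (Ffree x).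
have {}SP x y : S x -> S y -> x != y -> max_like eta a x y.
  by move=> Sx Sy xy; have [|/max_like_sym] := SP x y Sx Sy xy.
exists S; split => //.
(* As [S] is infinite, every point has a distinct partner in [S], and [max_like] for the pair
   includes positivity. *)
have aS (x : set_type S) : 0 < a (val x).
  have [y [Sy yx]] : exists y, S y /\ val x != y.
    apply: contrapT => /forallNP Sx; apply: Sinf.
    apply: sub_finite_set (finite_set1 (val x)) => y Sy /=.
    by apply/eqP/negPn/negP => yx; apply: (Sx y); rewrite eq_sym.
  by have [] := SP _ _ (set_valP x) Sy yx.
exists (max_space (a \o val) aS); split; first exact: ultrametric_max_space.
split; first by rewrite lerDl ltW.
(* This [r] turns the upper bound of [max_like] into the lower bound of the embedding; the lower
   bound of [max_like] then yields the factor [1 + eps]. *)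
exists id, (1 + eta)^-1; split; first by rewrite invr_gt0 addr_gt0.
move=> x y; have [->|xy] := eqVneq x y; first by rewrite !mdistxx !mulr0 lexx.
have [ax ay /andP[lo up]] := SP _ _ (set_valP x) (set_valP y) xy.
have -> : mdist (id x : max_space (a \o val) aS) (id y : max_space (a \o val) aS)
  = Num.max (a (val x)) (a (val y)) by rewrite /mdist /= /max_dist (negbTE xy).
have -> : mdist x y = mdist (val x) (val y) by [].
apply/andP; split; first by rewrite ler_pdivrMl ?addr_gt0.
rewrite -mulrA mulrCA ler_pdivlMl ?addr_gt0//.
have -> : 1 + eta = (1 + eps) * (1 - eta) by lra.
by rewrite -mulrA ler_pM2l ?addr_gt0.
Qed.
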